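(* For every graph $G$, $\mathcal R(G)\ge 1/\sqrt2$.
   Context: All graphs are finite and simple. For a graph $G$ with vertices $v_1,\dots,v_n$ let $D_G(t)$ be the symmetric $n\times n$ matrix with zero diagonal whose $(i,j)$ entry ($i\neq j$) is $1$ if $v_iv_j$ is an edge and $t$ otherwise. Put $M_G(t)=\det D_G(t)$ and let $C_G(t)=\det\begin{pmatrix}0&\mathbf 1^T\\ \mathbf 1&D_G(t)\end{pmatrix}$, where $\mathbf 1$ is the all-ones column of length $n$. Let $F_G(t)=-\frac12\,\frac{M_G(t)}{C_G(t)}$, viewed as a rational function (common factors cancelled; $F_G(t_0)<\infty$ means that $t_0$ is not a pole). Let $\tau_1(G)$ be the smallest real root of $C_G$ that is $>1$, and $\tau_1(G)=\infty$ if there is no such root. If $\tau_1(G)<\infty$ and $F_G(\tau_1(G))<\infty$, put $\mathcal R(G)=\sqrt{F_G(\tau_1(G))}$; otherwise $\mathcal R(G)=\infty$. *)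

(* Defs.v *)
From HB Require Import structures.
From mathcomp Require Import all_boot all_order all_algebra.
From mathcomp Require Import all_classical all_reals.

Set Implicit Arguments.
Unset Strict Implicit.
Unset Printing Implicit Defensive.

Import Order.TTheory GRing.Theory Num.Theory.
Local Open Scope classical_set_scope.
Local Open Scope ring_scope.

(* A finite simple graph on the vertices 0, ..., n-1 is an adjacency relation
   [e : rel 'I_n] that is symmetric and irreflexive. *)

Definition distmx (A : comNzRingType) (n : nat) (e : rel 'I_n) (t : A) :
    'M[A]_n :=
  \matrix_(i, j) if i == j then 0 else if e i j then 1 else t.

(* M_G and C_G are polynomials in the indeterminate t, rendered as 'X. *)
Definition Mpoly (R : realType) (n : nat) (e : rel 'I_n) : {poly R} :=
  \det (distmx e 'X).

Definition Cpoly (R : realType) (n : nat) (e : rel 'I_n) : {poly R} :=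
  \det (block_mx (0 : 'M_1) (const_mx 1) (const_mx 1) (distmx e 'X)).

(* Value at t of the rational function p / q, after cancelling common factors;
   for q != 0 the value is +oo exactly when t is a pole. *)
Definition ratfun_eval (R : realType) (p q : {poly R}) (t : R) : \bar R :=
  let p' := p %/ gcdp p q in
  let q' := q %/ gcdp p q in
  if root q' t then +oo%E else (p'.[t] / q'.[t])%:E.

Definition F_G (R : realType) (n : nat) (e : rel 'I_n) (t : R) : \bar R :=
  ratfun_eval (- 2^-1 *: Mpoly R e) (Cpoly R e) t.

Definition smallest_root_gt1 (R : realType) (p : {poly R}) (t : R) : Prop :=
  [/\ root p t, 1 < t & forall s, root p s -> 1 < s -> t <= s].

Definition tau1 (R : realType) (n : nat) (e : rel 'I_n) : \bar R :=
  xget +oo%E [set t%:E | t in [set t | smallest_root_gt1 (Cpoly R e) t]].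

(* [Num.sqrt] is 0 on negative numbers, so a lower bound [0 < c <= calR e]
   in the finite case also asserts that F_G (tau1) is positive. *)
Definition calR (R : realType) (n : nat) (e : rel 'I_n) : \bar R :=
  match tau1 R e with
  | EFin t => match F_G e t with
              | EFin v => (Num.sqrt v)%:E
              | _ => +oo%E
              end
  | _ => +oo%E
  end.

(* Main.v *)
Require Import Defs.
From HB Require Import structures.
From mathcomp Require Import all_boot all_order all_algebra.
From mathcomp Require Import all_classical all_reals.
From mathcomp Require Import topology normedtype derive.
From mathcomp Require Import ring lra.

Set Implicit Arguments.
Unset Strict Implicit.
Unset Printing Implicit Defensive.

Import Order.TTheory GRing.Theory Num.Theory.
Import numFieldNormedType.Exports.
Local Open Scope ring_scope.

(** Read D(t) as a table of squared distances, and call the sum of the entries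
    of a row vector its mass.  If t is such that D(t) is negative semidefinite
    on the vectors of mass 0 and C(t) <> 0, then -M(t)/C(t) is the maximum of
    a D(t) a^T over the vectors a of mass 1 (lemmas [circumcenter] and
    [circumcenter_max]): this is twice the squared circumradius of the simplex
    with these distances.

    On vectors of mass 0, D(t) acts as (t - 1) B - 1, where B is the adjacency
    matrix of the complement graph.  If this form took a positive value for
    some t > 1, the largest value mu of the Rayleigh quotient of B on mass 0
    would satisfy 1 + 1/mu < t, and the maximizing vector would make
    1 + 1/mu a root of C.  So D(t) is negative semidefinite on mass 0 for
    1 < t <= tau, where tau is the smallest root of C above 1
    ([distmx_cond_nsd]).  Letting t tend to tau from the left, a finite value
    of F at tau satisfies a D(tau) a^T <= 2 F(tau) for every a of mass 1
    ([F_G_ge_bform]).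

    Since C(tau) = 0, there is a vector z <> 0 of mass 0 such that z D(tau) is
    constant, say c (1, ..., 1).  Moving a mass 1 vector along z changes the
    value of the form linearly with slope 2c, so the upper bound forces c = 0
    ([bform_bounded_const0]).  Then write z as the difference of its positive
    and negative parts, scaled to have mass 1: this is a Radon partition of
    the degenerate simplex into two vectors p and m with disjoint supports and
    p D(tau) = m D(tau).  Hence p D(tau) p^T = p D(tau) m^T, an average of
    distances between different vertices, all of which are at least 1
    ([radon_pair_bform]).  So 2 F(tau) >= 1. *)

(** * Bilinear forms of matrices and the total mass of a vector *)

Section BilinearForm.
Variables (K : comNzRingType) (n : nat).
Implicit Types (A B : 'M[K]_n) (x y z : 'rV[K]_n) (a : K).

Definition bform A x y : K := (x *m A *m y^T) 0 0.

Definition mass x : K := \sum_i x 0 i.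

Lemma bformE A x y : bform A x y = \sum_i \sum_j x 0 i * A i j * y 0 j.
Proof.
rewrite /bform mxE exchange_big; apply: eq_bigr => j _.
by rewrite !mxE mulr_suml.
Qed.

Lemma bformDl A x y z : bform A (x + y) z = bform A x z + bform A y z.
Proof. by rewrite /bform !mulmxDl mxE. Qed.

Lemma bformDr A x y z : bform A x (y + z) = bform A x y + bform A x z.
Proof. by rewrite /bform linearD/= mulmxDr mxE. Qed.

Lemma bformZl A a x y : bform A (a *: x) y = a * bform A x y.
Proof. by rewrite /bform -!scalemxAl mxE. Qed.

Lemma bformZr A a x y : bform A x (a *: y) = a * bform A x y.
Proof. by rewrite /bform linearZ/= -scalemxAr mxE. Qed.

Lemma bformNr A x y : bform A x (- y) = - bform A x y.
Proof. by rewrite -scaleN1r bformZr mulN1r. Qed.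

Lemma bformC A x y : A^T = A -> bform A x y = bform A y x.
Proof.
move=> symA; rewrite /bform -[in RHS](trmxK (y *m A *m x^T)) [RHS]mxE.
by rewrite !trmx_mul trmxK symA mulmxA.
Qed.

Lemma bform1E x y : bform 1%:M x y = \sum_i x 0 i * y 0 i.
Proof. by rewrite /bform mulmx1 mxE; apply: eq_bigr => i _; rewrite mxE. Qed.

Lemma massD x y : mass (x + y) = mass x + mass y.
Proof. by rewrite -big_split; apply: eq_bigr => i _; rewrite mxE. Qed.

Lemma massZ a x : mass (a *: x) = a * mass x.
Proof. by rewrite /mass mulr_sumr; apply: eq_bigr => i _; rewrite mxE. Qed.

Lemma massN x : mass (- x) = - mass x.
Proof. by rewrite -scaleN1r massZ mulN1r. Qed.

Lemma mass_delta i : mass (delta_mx 0 i) = 1.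
Proof.
rewrite /mass (bigD1 i)//= !mxE !eqxx big1 ?addr0// => j ji.
by rewrite mxE (negPf ji) andbF.
Qed.

Lemma mulmx_const1 p x : x *m const_mx 1 = const_mx (mass x) :> 'rV_p.
Proof.
by apply/rowP => j; rewrite !mxE; apply: eq_bigr => i _; rewrite mxE mulr1.
Qed.

Lemma bform_const A x y a :
  x *m A = a *: const_mx 1 -> bform A x y = a * mass y.
Proof.
move=> xA; rewrite /bform xA -scalemxAl mxE mxE; congr (_ * _).
by apply: eq_bigr => i _; rewrite !mxE mul1r.
Qed.

End BilinearForm.

Lemma map_bform (K L : comNzRingType) (n : nat) (f : {rmorphism K -> L})
    (A : 'M[K]_n) (x y : 'rV_n) :
  f (bform A x y) = bform (map_mx f A) (map_mx f x) (map_mx f y).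
Proof. by rewrite /bform map_trmx -!map_mxM [RHS]mxE. Qed.

(** * The Cayley-Menger determinant *)

Section CayleyMenger.
Variables (K : fieldType) (n : nat).
Implicit Types (A : 'M[K]_n) (x y z : 'rV[K]_n) (c : K).

Definition cmmx A : 'M[K]_(1 + n) :=
  block_mx (0 : 'M_1) (const_mx 1) (const_mx 1) A.

Lemma mul_row_cmmx A (c : K) x :
  row_mx c%:M x *m cmmx A = row_mx (mass x)%:M (c *: const_mx 1 + x *m A).
Proof.
rewrite mul_row_block mulmx0 add0r mul_scalar_mx; congr row_mx.
by rewrite mulmx_const1; apply/rowP => j; rewrite !mxE ord1 eqxx.
Qed.

Lemma det_cmmx0 A x c : x != 0 -> mass x = 0 ->
  x *m A = c *: const_mx 1 -> \det (cmmx A) = 0.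
Proof.
move=> x0 mx xA; apply/eqP/det0P; exists (row_mx (- c)%:M x).
  by apply: contra x0 => /eqP; rewrite -row_mx0 => /eq_row_mx[_ ->].
by rewrite mul_row_cmmx mx xA -scalerDl addNr scale0r raddf0 row_mx0.
Qed.

Lemma det_cmmx_eq0 A : (0 < n)%N -> \det (cmmx A) = 0 ->
  exists x c, [/\ x != 0, mass x = 0 & x *m A = c *: const_mx 1].
Proof.
move=> n0 /eqP/det0P[v v0].
rewrite -[v]hsubmxK (mx11_scalar (lsubmx v)) mul_row_cmmx -row_mx0.
set c := lsubmx v 0 0; set x := rsubmx v.
move=> /eq_row_mx[/matrixP/(_ 0 0) + /eqP].
rewrite !mxE mulr1n => mx; rewrite addr_eq0 => /eqP cx.
exists x, (- c); split=> //; last by rewrite scaleNr cx opprK.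
apply: contra v0 => /eqP x0.
have c0 : c = 0.
  move: cx; rewrite x0 mul0mx oppr0 => /rowP/(_ (Ordinal n0)).
  by rewrite !mxE mulr1.
by rewrite -[v]hsubmxK (mx11_scalar (lsubmx v)) -/c -/x c0 x0 raddf0 row_mx0.
Qed.

(** By Cramer's rule, the barycentric coordinates of the circumcenter are a
    vector of mass 1 that the matrix sends to a constant one; the constant is
    twice the squared circumradius. *)
Lemma circumcenter A : \det (cmmx A) != 0 ->
  exists x c, [/\ mass x = 1, x *m A = c *: const_mx 1 &
    c * \det (cmmx A) = - \det A].
Proof.
move=> C0; have uC : cmmx A \in unitmx by rewrite unitmxE unitfE.
(* v is the first row of the inverse; replacing the first row of the identity
   by v turns the bordered matrix into a block triangular one. *)
pose v : 'rV_(1 + n) := row_mx 1%:M 0 *m invmx (cmmx A).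
have : v *m cmmx A = row_mx 1%:M 0 by rewrite mulmxKV.
clearbody v; rewrite -[v]hsubmxK (mx11_scalar (lsubmx v)) mul_row_cmmx.
set c := lsubmx v 0 0; set x := rsubmx v.
move=> /eq_row_mx[/matrixP/(_ 0 0)].
rewrite !mxE !mulr1n => mx /eqP; rewrite addrC addr_eq0 -scaleNr => /eqP cx.
exists x, (- c); split=> //.
have : block_mx c%:M x 0 1%:M *m cmmx A = block_mx 1%:M 0 (const_mx 1) A.
  rewrite mulmx_block mulmx0 add0r !mul0mx !mul1mx !add0r mul_scalar_mx.
  rewrite mulmx_const1 mx cx scaleNr subrr; congr block_mx.
  by apply/matrixP => i j; rewrite !mxE !ord1.
move=> /(congr1 determinant).
rewrite det_mulmx det_ublock det_lblock det_scalar1 !det1 mulr1 mul1r mulNr.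
by move=> ->.
Qed.

End CayleyMenger.

(** Without vertices C is the zero polynomial, so it has no smallest root
    above 1. *)
Lemma det_cmmx_nil (K : fieldType) (A : 'M[K]_0) : \det (cmmx A) = 0.
Proof.
apply/eqP/det0P; exists (row_mx 1%:M 0).
  by rewrite -row_mx0; apply/eqP => /eq_row_mx[/eqP]; rewrite oner_eq0.
rewrite mul_row_cmmx -row_mx0; congr row_mx; last by apply/rowP => -[].
by rewrite /mass big_ord0 raddf0.
Qed.

(** * Forms that are negative semidefinite on vectors of mass 0 *)

Section RealForms.
Variables (R : realFieldType) (n : nat).
Implicit Types (A : 'M[R]_n) (x y z a : 'rV[R]_n) (c : R).

Definition cond_nsd A := forall y, mass y = 0 -> bform A y y <= 0.

(** The circumcenter is a critical point of the form on the hyperplane of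
    mass 1, and the form is concave there. *)
Lemma circumcenter_max A x c a : A^T = A -> cond_nsd A ->
  mass x = 1 -> x *m A = c *: const_mx 1 -> mass a = 1 -> bform A a a <= c.
Proof.
move=> symA nsdA mx xA ma; pose y := a - x.
have my : mass y = 0 by rewrite massD massN ma mx subrr.
have -> : a = x + y by rewrite addrC subrK.
clearbody y; rewrite bformDl !bformDr (bformC y x)// !(bform_const _ xA).
rewrite mx my mulr1 mulr0.
by rewrite addr0 add0r gerDl nsdA.
Qed.

Lemma bform1_gt0 x : x != 0 -> 0 < bform 1%:M x x.
Proof.
rewrite bform1E => x0; rewrite lt_def sumr_ge0 ?andbT; last first.
  by move=> i _; rewrite -expr2 sqr_ge0.
apply: contra x0 => /eqP; move/psumr_eq0P => h; apply/eqP/rowP => i.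
rewrite mxE; apply/eqP; rewrite -(sqrf_eq0 (x 0 i)) expr2 h// => j _.
by rewrite -expr2 sqr_ge0.
Qed.

(** The positive and negative parts p and m of z have the same mass and the
    same image under A, so the values of A at (p, p) and at (p, m) agree; since
    p and m have disjoint supports, the second one only involves entries of A
    off the diagonal. *)
Lemma radon_pair_bform A z : A^T = A -> (forall i j, i != j -> 1 <= A i j) ->
  z != 0 -> mass z = 0 -> z *m A = 0 ->
  exists2 a, mass a = 1 & 1 <= bform A a a.
Proof.
move=> symA A1 z0 mz zA.
pose p : 'rV[R]_n := \row_i Num.max (z 0 i) 0.
pose m : 'rV[R]_n := \row_i Num.max (- z 0 i) 0.
have p0 i : 0 <= p 0 i by rewrite mxE le_max lexx orbT.
have m0 i : 0 <= m 0 i by rewrite mxE le_max lexx orbT.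
have zpm : z = p - m.
  apply/rowP => i; rewrite !mxE.
  by case: (leP (z 0 i) 0) => h; case: (leP (- z 0 i) 0) => h'; lra.
have pm i : p 0 i * m 0 i = 0.
  rewrite !mxE.
  by case: (leP (z 0 i) 0) => h; case: (leP (- z 0 i) 0) => h'; nra.
have mpm : mass p = mass m.
  by apply/eqP; rewrite -subr_eq0 -massN -massD -zpm mz.
have pp : bform A p p = bform A p m.
  apply/eqP; rewrite -subr_eq0 -bformNr -bformDr -zpm bformC//.
  by rewrite /bform zA mul0mx mxE.
have s0 : 0 < mass p.
  rewrite lt_def sumr_ge0 ?andbT//; apply: contra z0 => /eqP sp.
  have sm : mass m = 0 by rewrite -mpm.
  apply/eqP; rewrite zpm; apply/rowP => i; rewrite [LHS]mxE [(- m) 0 i]mxE.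
  by rewrite (psumr_eq0P _ sp)// (psumr_eq0P _ sm)// mxE subrr.
have le_pm : mass p * mass m <= bform A p m.
  rewrite bformE [mass p]/mass mulr_suml; apply: ler_sum => i _.
  rewrite [mass m]/mass mulr_sumr; apply: ler_sum => j _.
  have [<-|ij] := eqVneq i j; first by rewrite mulrAC pm mul0r.
  by rewrite mulrAC ler_peMr ?A1// mulr_ge0.
exists ((mass p)^-1 *: p); first by rewrite massZ mulVf// gt_eqF.
rewrite bformZl bformZr pp mulrA -invfM mulrC ler_pdivlMr ?mulr_gt0// mul1r.
by rewrite {2}mpm.
Qed.

(** Along a line of direction z in the hyperplane of mass 1, the form is affine
    with slope 2c. *)
Lemma bform_bounded_const0 A z c v : z *m A = c *: const_mx 1 -> A^T = A ->
  z != 0 -> mass z = 0 -> (forall a, mass a = 1 -> bform A a a <= v) -> c = 0.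
Proof.
move=> zA symA z0 mz le_v; apply/eqP/negPn/negP => c0.
have [i _] : exists i : 'I_n, true.
  have /existsP[i _] : [exists i, z 0 i != 0].
    apply: contraNT z0; rewrite negb_exists => /forallP h.
    by apply/eqP/rowP => i; rewrite mxE; apply/eqP/negPn.
  by exists i.
pose d : 'rV[R]_n := delta_mx 0 i.
(* At this parameter the form exceeds the bound v by exactly 1. *)
pose s := (v - bform A d d + 1) / (2 * c).
have := le_v (d + s *: z); rewrite massD massZ mz mulr0 addr0 mass_delta.
move=> /(_ erefl); rewrite bformDl !bformDr !bformZl !bformZr.
rewrite (bformC d z)// !(bform_const _ zA) mz mass_delta.
have -> : v = bform A d d + s * (2 * c) - 1.
  by rewrite /s divfK ?mulf_neq0// ?pnatr_eq0//; ring.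
lra.
Qed.

End RealForms.

(** As for any semidefinite form, an isotropic vector v lies in the kernel of
    the form restricted to mass 0; only the constant vectors are orthogonal to
    all differences of basis vectors, hence the constant c. *)
Lemma cond_nsd_isotropic (R : realFieldType) (n : nat)
    (A : 'M[R]_n) v : A^T = A -> cond_nsd A ->
  mass v = 0 -> bform A v v = 0 -> exists c, v *m A = c *: const_mx 1.
Proof.
move=> symA nsdA mv vv.
have orth y : mass y = 0 -> bform A v y = 0.
  move=> my; apply/eqP/negPn/negP => b0.
  pose b := bform A v y; pose q := bform A y y.
  have q0 : q <= 0 by exact: nsdA.
  have key s : 2 * s * b + s ^+ 2 * q <= 0.
    have := nsdA (v + s *: y); rewrite massD massZ mv my mulr0 addr0.
    move=> /(_ erefl); rewrite bformDl !bformDr !bformZl !bformZr vv.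
    by rewrite (bformC y v)// -/b -/q; lra.
  (* The maximizer - b / q is undefined for q = 0; dividing by 1 - q > 0
     instead still gives a positive value. *)
  have := key (b / (1 - q)).
  have q1 : 0 < 1 - q by lra.
  have -> : 2 * (b / (1 - q)) * b + (b / (1 - q)) ^+ 2 * q =
     b ^+ 2 * (2 - q) / (1 - q) ^+ 2 by field; rewrite gt_eqF.
  rewrite leNgt divr_gt0 ?exprn_gt0// mulr_gt0; [by []| |lra].
  by rewrite exprn_even_gt0.
case: n A v symA nsdA mv vv orth => [|k] A v symA nsdA mv vv orth.
  by exists 0; apply/rowP => -[].
exists ((v *m A) 0 0); apply/rowP => i; rewrite !mxE mulr1.
have := orth (delta_mx 0 i - delta_mx 0 0).
rewrite massD massN !mass_delta subrr => /(_ erefl)/eqP.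
rewrite bformDr bformNr subr_eq0 /bform => /eqP.
by rewrite !trmx_delta -!colE !mxE.
Qed.

(** * Maximum of a Rayleigh quotient on the vectors of mass 0 *)

Section Rayleigh.
Local Open Scope classical_set_scope.
Variables (R : realType) (n : nat).
Implicit Types (A B : 'M[R]_n) (x y z : 'rV[R]_n) (c : R).

Lemma continuous_sum (T : topologicalType) (I : Type) (r : seq I)
    (F : I -> T -> R) :
  (forall i, continuous (F i)) -> continuous (fun t => \sum_(i <- r) F i t).
Proof.
move=> cF; elim: r => [|i r IH] t.
  by under eq_fun do rewrite big_nil; exact: cvg_cst.
by under eq_fun do rewrite big_cons; apply: cvgD; [exact: cF|exact: IH].
Qed.

Lemma continuous_mass : continuous (@mass R n).
Proof. by apply: continuous_sum => i; exact: coord_continuous. Qed.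

Lemma continuous_bform A : continuous (fun x => bform A x x).
Proof.
have -> : (fun x => bform A x x) =
    (fun x => \sum_i \sum_j x 0 i * A i j * x 0 j).
  by apply/funext => x; exact: bformE.
apply: continuous_sum => i; apply: continuous_sum => j x.
apply: (@continuousM _ _ (fun x => x 0 i * A i j)).
  apply: (@continuousM _ _ (fun x => x 0 i)); first exact: coord_continuous.
  exact: cst_continuous.
exact: coord_continuous.
Qed.

Lemma compact_mass0_sphere :
  compact [set x : 'rV[R]_n | mass x = 0 /\ bform 1%:M x x = 1].
Proof.
apply: bounded_closed_compact.
  exists 1; split=> // M M1 x [_ x1]; apply: le_trans (ltW M1).
  rewrite [leLHS]/Num.norm /= mx_normrE.
  apply/bigmax_leP; split=> // -[i j] _ /=.
  rewrite -(@ler_pXn2r _ 2) ?nnegrE// expr1n -x1 bform1E (bigD1 j)//= ord1.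
  rewrite real_normK ?num_real// expr2 lerDl sumr_ge0// => k _.
  by rewrite -expr2 sqr_ge0.
apply: closedI.
  apply: (@preimage_closed _ _ (@mass R n) _ _ (@closed_eq R 0)).
  by move=> x _; exact: continuous_mass.
apply: (@preimage_closed _ _ (fun x => bform 1%:M x x) _ _ (@closed_eq R 1)).
by move=> x _; exact: continuous_bform.
Qed.

(** The maximum is attained on the compact unit sphere of the hyperplane of
    mass 0, where x0 gives a point; homogeneity extends the bound to all
    vectors of mass 0. *)
Lemma rayleigh_max B x0 : mass x0 = 0 -> x0 != 0 ->
  exists2 v, v != 0 /\ mass v = 0 & exists mu,
    bform B v v = mu * bform 1%:M v v /\
    (forall y, mass y = 0 -> bform B y y <= mu * bform 1%:M y y).
Proof.
move=> mx0 x00.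
pose S := [set x : 'rV[R]_n | mass x = 0 /\ bform 1%:M x x = 1].
have unitize y : mass y = 0 -> y != 0 ->
    S ((Num.sqrt (bform 1%:M y y))^-1 *: y).
  move=> my y0; have y1 := bform1_gt0 y0.
  split; first by rewrite massZ my mulr0.
  rewrite bformZl bformZr mulrA -invfM -expr2 sqr_sqrtr ?(ltW y1)//.
  by rewrite mulVf ?gt_eqF.
have [v] := EVT_max_rV (ex_intro _ _ (unitize x0 mx0 x00))
  compact_mass0_sphere (continuous_subspaceT (@continuous_bform B)).
rewrite inE => -[mv v1] vmax; exists v.
  split=> //; apply: contra_eq_neq v1 => ->.
  by rewrite -(scale0r 0) bformZl mul0r eq_sym oner_neq0.
exists (bform B v v); split; first by rewrite v1 mulr1.
move=> y my; have [->|y0] := eqVneq y 0.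
  by rewrite -(scale0r 0) !bformZl !mul0r mulr0.
have y1 := bform1_gt0 y0.
have := vmax _ (mem_set (unitize y my y0)).
rewrite bformZl bformZr mulrA -invfM -expr2 sqr_sqrtr ?(ltW y1)//.
by rewrite [leLHS]mulrC ler_pdivrMr.
Qed.

End Rayleigh.

(** * The two-distance matrix of a graph *)

Section DistancePencil.
Variables (n : nat) (e : rel 'I_n).

Lemma horner_distmx (K : comNzRingType) (t : K) :
  map_mx (horner_eval t) (distmx e 'X) = distmx e t.
Proof.
apply/matrixP => i j; rewrite !mxE /horner_eval.
case: ifP => _; first exact: horner0.
by case: ifP => _; rewrite ?hornerC ?hornerX.
Qed.

Lemma horner_Mpoly (R : realType) (t : R) :
  (Mpoly R e).[t] = \det (distmx e t).
Proof. by rewrite -[LHS]/(horner_eval t _) -det_map_mx horner_distmx. Qed.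

Lemma horner_Cpoly (R : realType) (t : R) :
  (Cpoly R e).[t] = \det (cmmx (distmx e t)).
Proof.
rewrite -[LHS]/(horner_eval t _) -det_map_mx (map_block_mx (horner_eval t)).
by rewrite horner_distmx map_mx0 !map_const_mx rmorph1.
Qed.

Definition compl_adj (K : comNzRingType) : 'M[K]_n :=
  \matrix_(i, j) ((i != j) && ~~ e i j)%:R.

Lemma mul_distmx_mass0 (K : comNzRingType) (t : K) (y : 'rV_n) :
  mass y = 0 -> y *m distmx e t = (t - 1) *: (y *m compl_adj K) - y.
Proof.
move=> my; have -> : distmx e t =
    const_mx 1 + ((t - 1) *: compl_adj K - 1%:M).
  apply/matrixP => i j; rewrite !mxE.
  by case: eqVneq => [->|ij] /=; [|case: (e i j)] => /=; ring.
by rewrite mulmxDr mulmx_const1 my raddf0 add0r mulmxBr mulmx1 scalemxAr.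
Qed.

Lemma bform_distmx_mass0 (K : comNzRingType) (t : K) (x y : 'rV_n) :
  mass x = 0 ->
  bform (distmx e t) x y = (t - 1) * bform (compl_adj K) x y - bform 1%:M x y.
Proof.
move=> mx; rewrite /bform mul_distmx_mass0// mulmxBl mulmx1 -scalemxAl.
by rewrite [LHS]mxE; congr (_ + _); rewrite [LHS]mxE.
Qed.

Hypothesis e_sym : symmetric e.

Lemma distmx_sym (K : comNzRingType) (t : K) : (distmx e t)^T = distmx e t.
Proof. by apply/matrixP => i j; rewrite !mxE eq_sym e_sym. Qed.

Variable R : realType.

(** The last t at which semidefiniteness on mass 0 still holds is a root of
    C: it is 1 + 1/mu, where mu > 0 is the maximum of the Rayleigh quotient of
    the complement graph, and the form has an isotropic vector there. *)
Lemma distmx_cond_nsd (t : R) : 1 < t ->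
  (forall s, 1 < s -> s < t -> (Cpoly R e).[s] != 0) ->
  cond_nsd (distmx e t).
Proof.
move=> t1 noroot y my; rewrite leNgt; apply/negP => pos.
have y0 : y != 0.
  by apply: contraTneq pos => ->; rewrite /bform !mul0mx mxE ltxx.
have [v [v0 mv] [mu [vB ray]]] := rayleigh_max (compl_adj R) my y0.
have yy := bform1_gt0 y0.
move: pos; rewrite bform_distmx_mass0// subr_gt0 => pos.
have tmu : 1 < (t - 1) * mu.
  rewrite -(ltr_pM2r yy) mul1r -mulrA (lt_le_trans pos)//.
  by rewrite ler_pM2l ?subr_gt0// ray.
have mu0 : 0 < mu by rewrite -(@pmulr_rgt0 _ (t - 1)) ?subr_gt0//; lra.
pose s := 1 + mu^-1.
have nsd : cond_nsd (distmx e s).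
  move=> x mx; rewrite bform_distmx_mass0// /s addrAC subrr add0r subr_le0.
  by rewrite mulrC ler_pdivrMr// mulrC ray.
have iso : bform (distmx e s) v v = 0.
  rewrite bform_distmx_mass0// /s addrAC subrr add0r vB mulKf ?subrr//.
  by rewrite gt_eqF.
have [c vc] := cond_nsd_isotropic (distmx_sym s) nsd mv iso.
have s1 : 1 < s by rewrite /s ltrDl invr_gt0.
have st : s < t by rewrite /s -ltrBrDl -div1r ltr_pdivrMr.
by have := noroot s s1 st; rewrite horner_Cpoly (det_cmmx0 v0 mv vc) eqxx.
Qed.

Local Open Scope classical_set_scope.

Lemma horner_ge0_at_right_end (p : {poly R}) (a b : R) : a < b ->
  (forall t, a < t -> t < b -> 0 <= p.[t]) -> 0 <= p.[b].
Proof.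
move=> ab p0.
apply: (@closed_cvg _ _ (at_left b) _ (horner p) [set x | 0 <= x]
  (@closed_ge R 0)).
  near=> t; apply: p0; near: t; [exact: nbhs_left_gt|exact: nbhs_left_lt].
exact/cvg_at_left_filter/continuous_horner.
Unshelve. all: end_near. Qed.

(** For s slightly below t, the value 2 F(s) is the maximum of the form of
    D(s) on mass 1.  Cancelling common factors makes F continuous at t, so the
    inequality passes to the limit. *)
Lemma F_G_ge_bform (t v : R) (a : 'rV[R]_n) :
  smallest_root_gt1 (Cpoly R e) t -> F_G e t = v%:E -> mass a = 1 ->
  bform (distmx e t) a a <= 2 * v.
Proof.
move=> [rt t1 tmin]; rewrite /F_G /ratfun_eval.
set P := _ *: Mpoly R e; set g := gcdp _ _.
set p := P %/ g; set q := Cpoly R e %/ g.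
case: ifPn => // nq [<-] ma.
have Pp : P = p * g by rewrite divpK// dvdp_gcdl.
have Cq : Cpoly R e = q * g by rewrite divpK// dvdp_gcdr.
have noroot s : 1 < s -> s < t -> (Cpoly R e).[s] != 0.
  by move=> s1 st; apply: contraTN st => rs; rewrite -leNgt tmin.
pose a' : 'rV[{poly R}]_n := map_mx polyC a.
pose w := bform (distmx e 'X) a' a'.
have wE s : w.[s] = bform (distmx e s) a a.
  rewrite -[LHS]/(horner_eval s w) map_bform horner_distmx.
  by congr bform; apply/rowP => i; rewrite /a' !mxE /= /horner_eval hornerC.
(* The inequality w <= 2 p / q multiplied by the square of q, so that it is
   polynomial and holds whatever the sign of q. *)
have : 0 <= (2%:P * p * q - w * q ^+ 2).[t].
  apply: (horner_ge0_at_right_end t1) => s s1 st.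
  have Cs := noroot s s1 st.
  move: (Cs); rewrite horner_Cpoly => Ds.
  have [x [c [mx xD cD]]] := circumcenter Ds.
  have nsd : cond_nsd (distmx e s).
    apply: distmx_cond_nsd => // u u1 us.
    by apply: noroot => //; exact: lt_trans st.
  have ac := circumcenter_max (distmx_sym s) nsd mx xD ma.
  have pc : 2 * p.[s] = c * q.[s].
    have gs : g.[s] != 0.
      by move: Cs; rewrite Cq hornerM mulf_eq0 negb_or => /andP[].
    apply: (mulIf gs); rewrite -!mulrA -!hornerM -Pp -Cq horner_Cpoly cD.
    by rewrite hornerZ horner_Mpoly mulNr mulrN mulVKf ?pnatr_eq0.
  rewrite !(hornerD, hornerN, hornerM, hornerC, horner_exp) wE pc.
  by rewrite -mulrA -expr2 -mulrBl mulr_ge0 ?sqr_ge0// subr_ge0.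
rewrite !(hornerD, hornerN, hornerM, hornerC, horner_exp) wE subr_ge0.
have q2 : 0 < q.[t] ^+ 2 by rewrite exprn_even_gt0//= -rootE.
rewrite -ler_pdivlMr// => /le_trans; apply.
by rewrite le_eqVlt; apply/orP/or_introl/eqP; field; rewrite -rootE.
Qed.

End DistancePencil.

Theorem theorem4p1 (R : realType) (n : nat) (e : rel 'I_n)
  (e_sym : symmetric e) (e_irr : irreflexive e) :
  ((1 / Num.sqrt 2)%:E <= calR R e)%E.
Proof.
rewrite /calR /tau1; case: xgetP => [_ _ [t /= tmin <-]|_]; last exact: leey.
case Fv: (F_G e t) => [v| |]; rewrite ?leey// lee_fin.
have max_v a := F_G_ge_bform e_sym tmin Fv (a := a).
have [rt t1 t_least] := tmin.
have n0 : (0 < n)%N.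
  rewrite lt0n; apply/eqP => n0.
  have : t <= (1 + t) / 2.
    apply: t_least; last by lra.
    by subst n; rewrite rootE horner_Cpoly det_cmmx_nil.
  lra.
have /(det_cmmx_eq0 n0)[z [c [z0 mz zD]]] : \det (cmmx (distmx e t)) = 0.
  by rewrite -horner_Cpoly; apply/eqP.
have Dsym := distmx_sym e_sym t.
have c0 : c = 0 by exact: (bform_bounded_const0 zD Dsym z0 mz max_v).
have zD0 : z *m distmx e t = 0 by rewrite zD c0 scale0r.
have D1 i j : i != j -> 1 <= distmx e t i j.
  by move=> ij; rewrite mxE (negPf ij); case: ifP => // _; exact: ltW.
have [a ma a1] := radon_pair_bform Dsym D1 z0 mz zD0.
have v2 : 1 / 2 <= v by have := max_v a ma; lra.
rewrite div1r -sqrtrV// -div1r ler_sqrt//; lra.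
Qed.
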